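(* Let $n \ge 1$, let $B_n \subset \mathbb{R}^n$ be the Euclidean ball of radius $\sqrt n$ centered at the origin, let $g = 1_{B_n}$, let $t \ge 0$, and for $y \in \mathbb{R}^n$ let $g_{t,y}(x) = g(\sqrt{1-e^{-2t}}\, x + e^{-t} y)$. For any half-space $A \subset \mathbb{R}^n$, $$\mathbb{E}_Y\big[\mathrm{Cov}(g_{t,Y}, 1_A)^2\big] \le \frac1n,$$ where $Y$ is a standard Gaussian vector in $\mathbb{R}^n$. In particular, for any $u > 0$, with probability at least $1 - u^{-2}$ over $Y \sim \mathcal{N}(0, I_n)$, $$|\mathrm{Cov}(g_{t,Y}, 1_A)| \le \frac{u}{\sqrt n}.$$
   Context: For fixed $y$, $\mathrm{Cov}(g_{t,y}, 1_A)$ is the covariance of functions on $\mathbb{R}^n$ with respect to the standard Gaussian measure $\gamma_n$. A half-space in $\mathbb{R}^n$ is a set of the form $\{x \in \mathbb{R}^n : \langle x, a\rangle \le b\}$ with $a \in \mathbb{R}^n$, $b \in \mathbb{R}$. *)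

(* Defs.v *)
From HB Require Import structures.
From mathcomp Require Import all_boot all_order all_algebra.
From mathcomp Require Import all_classical all_reals all_analysis.

Set Implicit Arguments.
Unset Strict Implicit.
Unset Printing Implicit Defensive.
Import Order.TTheory GRing.Theory Num.Theory.
Import numFieldNormedType.Exports.

Local Open Scope classical_set_scope.
Local Open Scope ring_scope.

(* Points of R^n are tuples, because n.-tuple R carries the product (Borel)
   sigma-algebra in the library. *)
Section euclidean_space.
Context {R : realType} {n : nat}.
Implicit Types x y a : n.-tuple R.

Definition dotp x y : R := \sum_(i < n) tnth x i * tnth y i.

Definition enorm x : R := Num.sqrt (dotp x x).

Definition lin_comb (c : R) x (d : R) y : n.-tuple R :=
  [tuple c * tnth x i + d * tnth y i | i < n].

Definition half_space (A : set (n.-tuple R)) : Prop :=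
  exists (a : n.-tuple R) (b : R), A = [set x | dotp x a <= b].

Definition sqrt_ball : set (n.-tuple R) :=
  [set x | enorm x <= Num.sqrt n%:R].

(* The function g_{t,y} for g the indicator of sqrt_ball. *)
Definition g_ (t : R) y : n.-tuple R -> R := fun x =>
  \1_sqrt_ball (lin_comb (Num.sqrt (1 - expR (- (2 * t)))) x (expR (- t)) y).

End euclidean_space.

Section gaussian_measure.
Context {R : realType}.

(* normal_prob lives on measurableTypeR R, whereas the coordinates of a tuple
   use the default measurable structure of R; the two sigma-algebras coincide. *)
Definition tcons n (x : measurableTypeR R * n.-tuple R) : n.+1.-tuple R :=
  [the n.+1.-tuple R of (x.1 : R) :: x.2].

Lemma measurable_tcons n : measurable_fun [set: _] (@tcons n).
Proof. exact: measurable_cons. Qed.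

HB.instance Definition _ n :=
  @isMeasurableFun.Build _ _ _ _ (@tcons n) (@measurable_tcons n).

(* The standard Gaussian measure on R^n: the n-fold product of N(0, 1). *)
Fixpoint gaussian n : probability (n.-tuple R) R :=
  match n with
  | 0 => \d_([tuple])
  | n.+1 => distribution (normal_prob 0 1 \x gaussian n)%E (@tcons n)
  end.

Lemma gaussian_box n (B : 'I_n -> set (measurableTypeR R)) :
  (forall i, measurable (B i)) ->
  gaussian n [set x | forall i, B i (tnth x i)] =
  (\prod_(i < n) normal_prob 0 1 (B i))%E.
Proof.
elim: n B => [|n IHn] B mB.
  by rewrite big_ord0 /= diracE mem_set// => -[].
rewrite big_ord_recl -IHn// -product_measure1E//; last first.
  rewrite (_ : [set x | _] = \bigcap_(i in [set: 'I_n])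
      ((@tnth n R ^~ i) @^-1` (B (lift ord0 i)))); last first.
    by apply/seteqP; split=> [x xB i _|x xB i]; exact: (xB i).
  apply: fin_bigcap_measurable; first exact: finite_finset.
  move=> i _; rewrite -[X in measurable X]setTI.
  exact: (measurable_tnth i measurableT (mB (lift ord0 i))).
apply: (congr1 (normal_prob 0 1 \x gaussian n)%E).
apply/seteqP; split=> [[x y] /= xyB|[x y] /= [xB yB] i].
  split; first exact: (xyB ord0).
  by move=> i; have := xyB (lift ord0 i); rewrite tnthS.
by case: (unliftP ord0 i) => [j|] ->; [rewrite tnthS; exact: yB|].
Qed.

Definition standard_gaussian_vector d (T : measurableType d)
    (P : probability T R) n (Y : {RV P >-> n.-tuple R}) : Prop :=
  forall B : set (n.-tuple R), measurable B -> distribution P Y B = gaussian n B.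

End gaussian_measure.
Arguments gaussian R n : clear implicits.
Arguments standard_gaussian_vector {R d T} P {n} Y.

(* Main.v *)
From HB Require Import structures.
Require Import Defs.
From mathcomp Require Import all_boot all_order all_algebra.
From mathcomp Require Import all_classical all_reals all_analysis.
From mathcomp Require Import measurable_realfun.
From mathcomp Require Import ring lra.
Set Implicit Arguments.
Unset Strict Implicit.
Unset Printing Implicit Defensive.
Import Order.TTheory GRing.Theory Num.Theory.
Import numFieldNormedType.Exports.

Local Open Scope classical_set_scope.
Local Open Scope ring_scope.

(** Write C_a(y) for the covariance of g_(t,y) with the indicator of the
    half-space <x, a> <= b, and F(a) for the Gaussian mean of C_a(y)^2 over y.

    The ball is invariant under rotations and so is the Gaussian measure.
    Rotating x and y simultaneously therefore does not change F
    (mean_sqr_halfspace_cov_isometry), and for a suitable number r, F(a) is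
    equal to F(r e_i) for every vector e_i of the standard basis
    (exists_gaussian_isometry). So n F(a) is the mean over y of the sum over i
    of C_(r e_i)(y)^2.

    The half-spaces r x_i <= b constrain distinct coordinates, hence are
    pairwise independent events: their centered indicators are orthogonal in
    L^2, with norm at most 1. For a fixed y the numbers C_(r e_i)(y) are the
    inner products of the indicator g_(t,y) with this orthogonal family, and
    Bessel's inequality bounds the sum of their squares by the squared norm of
    g_(t,y), which is at most 1 (sum_sqr_set_covariance_le1). Hence
    n F(a) <= 1; the deviation bound is Markov's inequality for the square.

    The rotations needed are products of plane rotations of two coordinates.
    A plane rotation preserves the product of two standard normal laws because
    the joint density depends on the squared norm only, and because it is a
    composition of three shears, each of which preserves iterated Lebesgue
    integrals by Tonelli's theorem and invariance under translations
    (ge0_integral2_normal_prob_rotate). *)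

(** * Rotations of a pair of independent standard normal variables *)

Section standard_normal_plane.
Context {R : realType}.
Local Notation mu := (@lebesgue_measure R).
Local Notation RR := (measurableTypeR R).
Local Open Scope ereal_scope.

(** The density of the normal law is a version of its Radon-Nikodym derivative,
    both having the same integral over every measurable set. *)
Lemma ge0_integral_normal_prob (f : RR -> \bar R) :
  measurable_fun [set: RR] f -> (forall x, 0 <= f x) ->
  \int[@normal_prob R 0%R 1%R]_x f x =
  \int[mu]_x (f x * (normal_pdf 0%R 1%R x)%:E).
Proof.
move=> mf f0.
have dom := @normal_prob_dominates R 0%R 1%R.
rewrite -(Radon_Nikodym_SigmaFinite.change_of_variables dom)//.
apply: ae_eq_integral => //.
- apply: emeasurable_funM => //.
  exact: measurable_int (Radon_Nikodym_SigmaFinite.f_integrable dom).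
- apply: emeasurable_funM => //; apply/measurable_EFinP.
  exact: measurable_normal_pdf.
- apply: ae_eqe_mul2l; apply: integral_ae_eq => //.
  + exact: Radon_Nikodym_SigmaFinite.f_integrable.
  + by apply/measurable_EFinP; exact: measurable_normal_pdf.
  + by move=> E _ mE; rewrite -Radon_Nikodym_SigmaFinite.f_integral.
Qed.

(** Both measures agree on half-open intervals, which characterize Lebesgue
    measure. *)
Lemma lebesgue_measure_translation (c : R) (B : set RR) : measurable B ->
  pushforward mu (fun x : RR => (x + c)%R : RR) B = mu B.
Proof.
move=> mB.
have mc : measurable_fun [set: RR] (fun x : RR => (x + c)%R : RR).
  by apply: measurable_funD.
pose H := isMeasurableFun.Build _ _ _ _ (fun x : RR => (x + c)%R : RR) mc.
pose h : {mfun RR >-> RR} := HB.pack (fun x : RR => (x + c)%R : RR) H.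
apply/esym.
apply: (@lebesgue_measure_unique R (pushforward mu h)) => //= _ [[a b]] _ <-.
rewrite /pushforward/=.
rewrite [X in _ = mu X](_ : _ = `](a - c)%R, (b - c)%R]%classic).
  rewrite !lebesgue_measure_itv/= !lte_fin ltrD2r -!EFinB.
  by have -> : ((b - c) - (a - c) = b - a)%R by ring.
by apply/seteqP; split=> x /=; rewrite !in_itv/= ltrBlDr lerBrDr.
Qed.

Lemma ge0_integral_translation (c : R) (f : RR -> \bar R) :
  measurable_fun [set: RR] f -> (forall x, 0 <= f x) ->
  \int[mu]_x f (x + c)%R = \int[mu]_x f x.
Proof.
move=> mf f0.
have mc : measurable_fun [set: RR] (fun x : RR => (x + c)%R : RR).
  by apply: measurable_funD.
transitivity (\int[pushforward mu (fun x : RR => (x + c)%R : RR)]_x f x).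
  by rewrite ge0_integral_pushforward.
apply: eq_measure_integral => // A mA _; exact: lebesgue_measure_translation.
Qed.

Definition rotate (c s : R) (z : RR * RR) : RR * RR :=
  ((c * z.1 - s * z.2)%R, (s * z.1 + c * z.2)%R).

Definition shear1 (a : R) (z : RR * RR) : RR * RR := ((z.1 + a * z.2)%R, z.2).

Definition shear2 (a : R) (z : RR * RR) : RR * RR := (z.1, (z.2 + a * z.1)%R).

Lemma measurable_rotate c s : measurable_fun [set: RR * RR] (rotate c s).
Proof.
apply: measurable_fun_pair.
  by apply: measurable_funB; apply: measurable_funM.
by apply: measurable_funD; apply: measurable_funM.
Qed.

Lemma measurable_shear1 a : measurable_fun [set: RR * RR] (shear1 a).
Proof.
apply: measurable_fun_pair => //.
by apply: measurable_funD => //; exact: measurable_funM.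
Qed.

Lemma measurable_shear2 a : measurable_fun [set: RR * RR] (shear2 a).
Proof.
apply: measurable_fun_pair => //.
by apply: measurable_funD => //; exact: measurable_funM.
Qed.

(** The classical decomposition of the rotation of angle theta, with
    s = sin theta; the coefficient (c - 1) / s is - tan (theta / 2), which has
    a pole at the half-turn. *)
Lemma rotate_shears (c s : R) : (c ^+ 2 + s ^+ 2 = 1)%R -> s != 0%R ->
  rotate c s =
  shear1 ((c - 1) / s)%R \o shear2 s \o shear1 ((c - 1) / s)%R.
Proof.
move=> cs1 s0; apply/funext => -[x y]; set a := ((c - 1) / s)%R.
have as1 : (a * s = c - 1)%R by rewrite /a divfK.
have ac1 : (a * (1 + c) = - s)%R.
  by apply: (mulIf s0); rewrite mulrAC as1 mulNr; lra.
rewrite /rotate /shear1 /shear2/=; congr (_, _).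
  transitivity (x + a * y * (2 + a * s) + a * s * x)%R; last by ring.
  have -> : (a * y * (2 + a * s) = a * (1 + c) * y)%R by rewrite as1; ring.
  by rewrite ac1 as1; ring.
transitivity (y + s * x + a * s * y)%R; last by ring.
by rewrite as1; ring.
Qed.

Definition lebesgue2_integral (f : RR * RR -> \bar R) :=
  \int[mu]_x \int[mu]_y f (x, y).

(** For a fixed second coordinate a horizontal shear is a translation of the
    first one; Tonelli's theorem makes the first coordinate the inner variable
    of integration. *)
Lemma lebesgue2_integral_shear1 (a : R) (f : RR * RR -> \bar R) :
  measurable_fun [set: RR * RR] f -> (forall x, 0 <= f x) ->
  lebesgue2_integral (f \o shear1 a) = lebesgue2_integral f.
Proof.
move=> mf f0; rewrite /lebesgue2_integral.
rewrite (fubini_tonelli (f \o shear1 a)); last 2 first.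
- by apply: (measurableT_comp mf); exact: measurable_shear1.
- by move=> z; exact: f0.
apply: etrans _ (esym (fubini_tonelli f mf f0)).
apply: eq_integral => y _.
rewrite /shear1/= (ge0_integral_translation (a * y) (f := fun x => f (x, y)))//.
by apply: (measurableT_comp mf); apply: measurable_fun_pair.
Qed.

Lemma lebesgue2_integral_shear2 (a : R) (f : RR * RR -> \bar R) :
  measurable_fun [set: RR * RR] f -> (forall x, 0 <= f x) ->
  lebesgue2_integral (f \o shear2 a) = lebesgue2_integral f.
Proof.
move=> mf f0; apply: eq_integral => x _.
rewrite /shear2/= (ge0_integral_translation (a * x) (f := fun y => f (x, y)))//.
by apply: (measurableT_comp mf); apply: measurable_fun_pair.
Qed.

Lemma lebesgue2_integral_rotate (c s : R) (f : RR * RR -> \bar R) :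
  (c ^+ 2 + s ^+ 2 = 1)%R -> s != 0%R ->
  measurable_fun [set: RR * RR] f -> (forall x, 0 <= f x) ->
  lebesgue2_integral (f \o rotate c s) = lebesgue2_integral f.
Proof.
move=> cs1 s0 mf f0; rewrite (rotate_shears cs1 s0) !compA.
have mf1 := measurableT_comp mf (measurable_shear1 ((c - 1) / s)%R).
have mf2 := measurableT_comp mf1 (measurable_shear2 s).
have f1 z : 0 <= (f \o shear1 ((c - 1) / s)) z by exact: f0.
have f2 z : 0 <= (f \o shear1 ((c - 1) / s) \o shear2 s) z by exact: f0.
apply: etrans (lebesgue2_integral_shear1 _ mf2 f2) _.
apply: etrans (lebesgue2_integral_shear2 _ mf1 f1) _.
exact: lebesgue2_integral_shear1.
Qed.

Definition normal_pdf2 (z : RR * RR) : R :=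
  (normal_pdf 0 1 z.1 * normal_pdf 0 1 z.2)%R.

Lemma normal_pdf2_ge0 z : (0 <= normal_pdf2 z)%R.
Proof. by rewrite mulr_ge0// normal_pdf_ge0. Qed.

Lemma measurable_normal_pdf2 : measurable_fun [set: RR * RR] normal_pdf2.
Proof.
by apply: measurable_funM; apply: measurableT_comp => //;
  exact: measurable_normal_pdf.
Qed.

Lemma normal_pdf2_rotate (c s : R) z : (c ^+ 2 + s ^+ 2 = 1)%R ->
  normal_pdf2 (rotate c s z) = normal_pdf2 z.
Proof.
case: z => x y cs1; rewrite /normal_pdf2 !normal_pdfE ?oner_eq0// /rotate/=.
rewrite [LHS]mulrACA [RHS]mulrACA; congr (_ * _)%R.
rewrite /normal_fun -!expRD; congr expR.
rewrite !subr0 -!mulrDl; congr (_ * _)%R.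
rewrite -!opprD; congr (- _)%R.
transitivity ((c ^+ 2 + s ^+ 2) * (x ^+ 2 + y ^+ 2))%R; first by ring.
by rewrite cs1 mul1r.
Qed.

Local Notation N01 := (@normal_prob R 0%R 1%R).

Lemma ge0_integral2_normal_prob (f : RR * RR -> \bar R) :
  measurable_fun [set: RR * RR] f -> (forall x, 0 <= f x) ->
  \int[N01]_x \int[N01]_y f (x, y) =
  lebesgue2_integral (fun z => f z * (normal_pdf2 z)%:E).
Proof.
move=> mf f0.
have mfx x : measurable_fun [set: RR] (fun y => f (x, y)).
  by apply: (measurableT_comp mf); apply: measurable_fun_pair.
have mpdf : measurable_fun [set: RR] (fun y => (@normal_pdf R 0%R 1%R y)%:E).
  by apply/measurable_EFinP; exact: measurable_normal_pdf.
rewrite ge0_integral_normal_prob.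
- apply: eq_integral => x _.
  rewrite ge0_integral_normal_prob// -ge0_integralZr//.
  + apply: eq_integral => y _.
    by rewrite /normal_pdf2 EFinM [X in _ = _ * X]muleC muleA.
  + exact: emeasurable_funM.
  + by move=> y _; rewrite mule_ge0// lee_fin normal_pdf_ge0.
  + by rewrite lee_fin normal_pdf_ge0.
- exact: (measurable_fun_fubini_tonelli_F f).
- by move=> x; apply: integral_ge0.
Qed.

(** The joint density is a function of the squared norm, so the invariance of
    the Lebesgue integral passes to the Gaussian one. *)
Lemma ge0_integral2_normal_prob_rotate (c s : R) (f : RR * RR -> \bar R) :
  (c ^+ 2 + s ^+ 2 = 1)%R -> s != 0%R ->
  measurable_fun [set: RR * RR] f -> (forall x, 0 <= f x) ->
  \int[N01]_x \int[N01]_y f (rotate c s (x, y)) =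
  \int[N01]_x \int[N01]_y f (x, y).
Proof.
move=> cs1 s0 mf f0.
rewrite (ge0_integral2_normal_prob (f := f \o rotate c s)); last 2 first.
- by apply: (measurableT_comp mf); exact: measurable_rotate.
- by move=> z; exact: f0.
rewrite [RHS](ge0_integral2_normal_prob mf f0).
rewrite -[RHS](lebesgue2_integral_rotate cs1 s0).
- congr lebesgue2_integral; apply/funext => z /=.
  by rewrite (normal_pdf2_rotate z cs1).
- apply: emeasurable_funM => //; apply/measurable_EFinP.
  exact: measurable_normal_pdf2.
- by move=> z; rewrite mule_ge0// lee_fin normal_pdf2_ge0.
Qed.
End standard_normal_plane.

(** * Linear isometries preserving the Gaussian measure *)

Section isometries.
Context {R : realType}.
Local Notation RR := (measurableTypeR R).

Definition tbehead n (z : n.+1.-tuple R) : n.-tuple R := [tuple of behead z].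

Lemma thead_tcons n (x : R) (z : n.-tuple R) : thead (tcons (x, z)) = x.
Proof. by []. Qed.

Lemma tbehead_tcons n (x : R) (z : n.-tuple R) : tbehead (tcons (x, z)) = z.
Proof. exact: val_inj. Qed.

Lemma tcons_eta n (z : n.+1.-tuple R) : z = tcons (thead z, tbehead z).
Proof. by rewrite {1}(tuple_eta z); exact: val_inj. Qed.

Lemma tnth_tbehead n (z : n.+1.-tuple R) i :
  tnth (tbehead z) i = tnth z (lift ord0 i).
Proof. by rewrite {2}(tcons_eta z) tnthS. Qed.

Lemma dotpS n (x y : n.+1.-tuple R) :
  dotp x y = thead x * thead y + dotp (tbehead x) (tbehead y).
Proof.
rewrite /dotp big_ord_recl; congr (_ + _).
by apply: eq_bigr => i _; rewrite !tnth_tbehead.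
Qed.

Lemma lin_combS n c d (x y : n.+1.-tuple R) :
  lin_comb c x d y =
  tcons (c * thead x + d * thead y, lin_comb c (tbehead x) d (tbehead y)).
Proof.
apply: eq_from_tnth => i; rewrite tnth_mktuple.
case: (unliftP ord0 i) => [j|] ->//.
by rewrite tnthS tnth_mktuple !tnth_tbehead.
Qed.

Lemma measurable_thead n : measurable_fun [set: n.+1.-tuple R] (@thead n R).
Proof. exact: measurable_tnth. Qed.

Lemma measurable_tbehead n : measurable_fun [set: n.+1.-tuple R] (@tbehead n).
Proof. exact: measurable_behead. Qed.

Lemma measurable_tcons_cst n (x : RR) :
  measurable_fun setT (fun z : n.-tuple R => tcons (x, z)).
Proof.
apply: measurable_cons; first exact: measurable_cst.
exact: measurable_id.
Qed.

Local Open Scope ereal_scope.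
Local Notation N01 := (@normal_prob R 0%R 1%R).

Lemma ge0_integral_gaussianS n (f : n.+1.-tuple R -> \bar R) :
  measurable_fun [set: n.+1.-tuple R] f -> (forall z, 0 <= f z) ->
  \int[gaussian R n.+1]_z f z =
  \int[N01]_x \int[gaussian R n]_z f (tcons (x, z)).
Proof.
move=> mf f0; rewrite ge0_integral_distribution//.
rewrite (fubini_tonelli1 (f \o @tcons R n))//; last by move=> z; exact: f0.
by apply: (measurableT_comp mf); exact: measurable_tcons.
Qed.

(** Invariance of the measure is stated for integrals of nonnegative functions,
    the form in which Tonelli's theorem applies to it. The clause on linear
    combinations is linearity, phrased with the operation that occurs in the
    definition of g_(t,y). *)
Record gaussian_isometry n (T : n.-tuple R -> n.-tuple R) : Prop := {
  isom_measurable : measurable_fun setT T ;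
  isom_integral : forall f : n.-tuple R -> \bar R, measurable_fun setT f ->
    (forall x, 0 <= f x) ->
    \int[gaussian R n]_x f (T x) = \int[gaussian R n]_x f x ;
  isom_lin_comb : forall c x d y,
    T (lin_comb c x d y) = lin_comb c (T x) d (T y) ;
  isom_dotp : forall x, dotp (T x) (T x) = dotp x x }.

Lemma gaussian_isometry_id n : @gaussian_isometry n id.
Proof. by []. Qed.

Lemma gaussian_isometry_comp n (S T : n.-tuple R -> n.-tuple R) :
  gaussian_isometry S -> gaussian_isometry T ->
  gaussian_isometry (S \o T).
Proof.
move=> [mS iS lS dS] [mT iT lT dT]; split.
- exact: measurableT_comp.
- move=> f mf f0; rewrite -(iS f)//.
  by apply: (iT (f \o S)) => [|z]; [exact: measurableT_comp|exact: f0].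
- by move=> c x d y /=; rewrite lT lS.
- by move=> x /=; rewrite dS dT.
Qed.

Definition extend_isometry n (T : n.-tuple R -> n.-tuple R) :=
  fun z : n.+1.-tuple R => tcons (thead z : RR, T (tbehead z)).

Lemma extend_isometryE n (T : n.-tuple R -> n.-tuple R) (x : RR) z :
  extend_isometry T (tcons (x, z)) = tcons (x, T z).
Proof. by rewrite /extend_isometry thead_tcons tbehead_tcons. Qed.

Lemma extend_isometryP n (T : n.-tuple R -> n.-tuple R) :
  gaussian_isometry T -> gaussian_isometry (extend_isometry T).
Proof.
move=> [mT iT lT dT].
have mE : measurable_fun setT (extend_isometry T).
  apply: measurable_cons; first exact: measurable_thead.
  by apply: (measurableT_comp mT); exact: measurable_tbehead.
split => //.
- move=> f mf f0; rewrite [RHS]ge0_integral_gaussianS//.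
  have mfE := measurableT_comp mf mE.
  apply: etrans (ge0_integral_gaussianS mfE (fun z => f0 _)) _.
  apply: eq_integral => x _; rewrite -(iT (fun z => f (tcons (x, z))))//.
    by apply: eq_integral => z _; rewrite [LHS]/comp extend_isometryE.
  exact: (measurableT_comp mf (measurable_tcons_cst _)).
- move=> c x d y.
  rewrite /extend_isometry lin_combS thead_tcons tbehead_tcons lT.
  by rewrite [RHS]lin_combS !thead_tcons !tbehead_tcons.
- by move=> x; rewrite /extend_isometry !dotpS !thead_tcons !tbehead_tcons dT.
Qed.

Definition rotate_heads n (c s : R) (z : n.+2.-tuple R) : n.+2.-tuple R :=
  let xy := rotate c s (thead z, thead (tbehead z)) in
  tcons (xy.1, tcons (xy.2, tbehead (tbehead z))).

Lemma rotate_headsE n c s (x y : RR) (w : n.-tuple R) :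
  rotate_heads c s (tcons (x, tcons (y, w))) =
  tcons ((rotate c s (x, y)).1, tcons ((rotate c s (x, y)).2, w)).
Proof. by rewrite /rotate_heads !(thead_tcons, tbehead_tcons). Qed.

Lemma measurable_rotate_heads n c s :
  measurable_fun setT (@rotate_heads n c s).
Proof.
have m1 := @measurable_thead n.+1.
have m2 : measurable_fun setT (fun z : n.+2.-tuple R => thead (tbehead z)).
  by apply: (measurableT_comp (@measurable_thead n)); exact: measurable_tbehead.
apply: measurable_cons.
  by apply: measurable_funB; apply: measurable_funM.
apply: measurable_cons.
  by apply: measurable_funD; apply: measurable_funM.
apply: (measurableT_comp (@measurable_tbehead n)).
exact: measurable_tbehead.
Qed.

(** Integrating out the coordinates from the third on leaves a function of the
    first two, to which the invariance in the plane applies. *)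
Lemma rotate_heads_isometry n c s : (c ^+ 2 + s ^+ 2 = 1)%R -> s != 0%R ->
  gaussian_isometry (@rotate_heads n c s).
Proof.
move=> cs1 s0; have mr := @measurable_rotate_heads n c s; split => //.
- move=> f mf f0.
  have split2 (h : n.+2.-tuple R -> \bar R) : measurable_fun setT h ->
      (forall z, 0 <= h z) -> \int[gaussian R n.+2]_z h z =
      \int[N01]_x \int[N01]_y \int[gaussian R n]_w
        h (tcons (x, tcons (y, w))).
    move=> mh h0; rewrite ge0_integral_gaussianS//.
    apply: eq_integral => x _; rewrite ge0_integral_gaussianS//.
    exact: (measurableT_comp mh (measurable_tcons_cst _)).
  rewrite [RHS]split2//.
  have mfr := measurableT_comp mf mr.
  apply: etrans (split2 _ mfr (fun z => f0 _)) _.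
  pose g (xy : RR * RR) := \int[gaussian R n]_w
    f (tcons (xy.1, tcons (xy.2, w))).
  have g0 xy : 0 <= g xy by apply: integral_ge0.
  have mg : measurable_fun setT g.
    apply: (measurable_fun_fubini_tonelli_F (fun z : (RR * RR) * n.-tuple R =>
      f (tcons (z.1.1, tcons (z.1.2, z.2)))%R)) => //.
    apply: (measurableT_comp mf).
    have m1 : measurable_fun setT (fun z : (RR * RR) * n.-tuple R => z.1.1).
      exact: (measurableT_comp measurable_fst measurable_fst).
    have m2 : measurable_fun setT (fun z : (RR * RR) * n.-tuple R => z.1.2).
      exact: (measurableT_comp measurable_snd measurable_fst).
    apply: measurable_cons; first exact: m1.
    by apply: measurable_cons; [exact: m2|exact: measurable_snd].
  apply: etrans (ge0_integral2_normal_prob_rotate cs1 s0 mg g0).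
  apply: eq_integral => x _; apply: eq_integral => y _.
  by apply: eq_integral => w _; rewrite [LHS]/comp rotate_headsE.
- move=> a x b y.
  rewrite /rotate_heads !lin_combS !(thead_tcons, tbehead_tcons)/=.
  by congr tcons; congr (_, tcons (_, _)); ring.
- move=> x; rewrite /rotate_heads !dotpS !(thead_tcons, tbehead_tcons)/=.
  rewrite [RHS]addrA addrA; congr (_ + _)%R.
  transitivity ((c ^+ 2 + s ^+ 2) *
    (thead x * thead x + thead (tbehead x) * thead (tbehead x)))%R.
    by ring.
  by rewrite cs1 mul1r.
Qed.

End isometries.

(** * Aligning a vector with the first axis *)

Section alignment.
Context {R : realType}.

(** By induction on the dimension: the tail of a is first aligned with the
    second axis, then one plane rotation moves it into the first axis. When
    the tail vanishes, that rotation would be trivial or a half-turn, which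
    three shears do not produce; it is then omitted, and rho is the first
    entry of a, whatever its sign. The last two
    conclusions determine rho when the entries of a are nonnegative. *)
Lemma exists_gaussian_isometry n (a : n.+1.-tuple R) :
  exists (T : n.+1.-tuple R -> n.+1.-tuple R) (rho : R),
  [/\ gaussian_isometry T,
      forall x, dotp (T x) a = rho * thead x,
      rho ^+ 2 = dotp a a &
      (forall i, 0 <= tnth a i) -> 0 <= rho].
Proof.
elim: n a => [|n IH] a.
  have dot1 (x y : 1.-tuple R) : dotp x y = thead x * thead y.
    by rewrite dotpS /dotp big_ord0 addr0.
  exists id, (thead a); split.
  - exact: gaussian_isometry_id.
  - by move=> x; rewrite dot1 mulrC.
  - by rewrite dot1 expr2.
  - by apply.
have [T [r [isoT Ta r2 r0]]] := IH (tbehead a).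
have isoE := extend_isometryP isoT.
have [rE|rN0] := eqVneq r 0.
  exists (extend_isometry T), (thead a); split => //.
  - move=> x.
    by rewrite dotpS thead_tcons tbehead_tcons Ta rE mul0r addr0 mulrC.
  - by rewrite dotpS -r2 rE expr2 expr0n addr0.
  - by move=> a0; exact: (a0 ord0).
pose rho := Num.sqrt (thead a ^+ 2 + r ^+ 2).
have pos : 0 < thead a ^+ 2 + r ^+ 2.
  by rewrite ltr_wpDl ?sqr_ge0// lt_neqAle eq_sym sqrf_eq0 rN0 sqr_ge0.
have rho2 : rho ^+ 2 = thead a ^+ 2 + r ^+ 2 by rewrite sqr_sqrtr// ltW.
have rhoN0 : rho != 0 by rewrite gt_eqF// sqrtr_gt0.
have cs1 : (thead a / rho) ^+ 2 + (r / rho) ^+ 2 = 1.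
  by rewrite !exprMn -mulrDl -rho2 -exprMn divff// expr1n.
have s0 : r / rho != 0 by rewrite mulf_neq0// invr_neq0.
exists (extend_isometry T \o rotate_heads (thead a / rho) (r / rho)), rho.
split.
- exact: gaussian_isometry_comp isoE (rotate_heads_isometry _ cs1 s0).
- move=> x; rewrite dotpS [rotate_heads _ _]lock /= -lock.
  rewrite /extend_isometry thead_tcons tbehead_tcons Ta.
  rewrite /rotate_heads !(thead_tcons, tbehead_tcons)/=.
  transitivity ((rho ^+ 2 / rho) * thead x); last by rewrite expr2 mulfK.
  by rewrite rho2; field.
- by rewrite rho2 dotpS r2 expr2.
- by move=> _; exact: sqrtr_ge0.
Qed.

End alignment.

(** * Bessel's inequality *)

Section bessel.
Context d (T : measurableType d) (R : realType).
Variable mu : {measure set T -> \bar R}.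

Lemma integrable_Rintegral_sum (I : Type) (r : seq I) (F : I -> T -> R) :
  (forall i, mu.-integrable setT (EFin \o F i)) ->
  mu.-integrable setT (EFin \o (fun x => \sum_(i <- r) F i x)) /\
  \int[mu]_x (\sum_(i <- r) F i x) = \sum_(i <- r) \int[mu]_x F i x.
Proof.
move=> iF; elim: r => [|i r [iS IH]].
  split.
    under [X in EFin \o X]eq_fun do rewrite big_nil.
    exact: integrable0.
  rewrite big_nil; under eq_Rintegral do rewrite big_nil.
  by rewrite Rintegral_cst// mul0r.
split.
  under [X in EFin \o X]eq_fun do rewrite big_cons.
  exact: (integrableD _ (iF i) iS).
rewrite big_cons -IH; under eq_Rintegral do rewrite big_cons.
by rewrite (RintegralD _ (iF i) iS).
Qed.

(** With c_i the inner product of g and e_i, the integral of the nonnegative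
    function (g - sum_i c_i e_i)^2 is
    |g|^2 - 2 sum_i c_i^2 + sum_i c_i^2 v_i, which is at most
    |g|^2 - sum_i c_i^2 because v_i <= 1. *)
Lemma Bessel_inequality n (g : T -> R) (e : 'I_n -> T -> R) (v : 'I_n -> R) :
  mu.-integrable setT (EFin \o (fun x => g x * g x)) ->
  (forall i, mu.-integrable setT (EFin \o (fun x => g x * e i x))) ->
  (forall i j, mu.-integrable setT (EFin \o (fun x => e i x * e j x))) ->
  (forall i j, \int[mu]_x (e i x * e j x) = if i == j then v i else 0) ->
  (forall i, v i <= 1) ->
  \sum_(i < n) (\int[mu]_x (g x * e i x)) ^+ 2 <= \int[mu]_x (g x * g x).
Proof.
move=> igg ige iee ort v1; set c := fun i => \int[mu]_x (g x * e i x).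
have : 0 <= \int[mu]_x ((g x - \sum_(i < n) c i * e i x) ^+ 2).
  by apply: Rintegral_ge0 => x _; exact: sqr_ge0.
have -> : (fun x => (g x - \sum_(i < n) c i * e i x) ^+ 2) =
    (fun x => g x * g x + (\sum_(i < n) (- 2 * c i) * (g x * e i x) +
      \sum_(i < n) \sum_(j < n) (c i * c j) * (e i x * e j x))).
  apply/funext => x.
  have -> : \sum_(i < n) (- 2 * c i) * (g x * e i x) =
      - 2 * (g x * \sum_(i < n) c i * e i x).
    by rewrite !mulr_sumr; apply: eq_bigr => i _; ring.
  have -> : \sum_(i < n) \sum_(j < n) (c i * c j) * (e i x * e j x) =
      (\sum_(i < n) c i * e i x) * (\sum_(i < n) c i * e i x).
    rewrite mulr_suml; apply: eq_bigr => i _; rewrite mulr_sumr.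
    by apply: eq_bigr => j _; ring.
  by ring.
have iZ k f : mu.-integrable setT (EFin \o f) ->
    mu.-integrable setT (EFin \o (fun x => k * f x)).
  by move=> If; exact: (integrableZl _ _ If).
have i1 i := iZ (- 2 * c i) _ (ige i).
have i2 i j := iZ (c i * c j) _ (iee i j).
have i3 i := (integrable_Rintegral_sum (index_enum 'I_n) (i2 i)).1.
have [S1 E1] := integrable_Rintegral_sum (index_enum 'I_n) i1.
have [S2 E2] := integrable_Rintegral_sum (index_enum 'I_n) i3.
have S12 := integrableD measurableT S1 S2.
rewrite (RintegralD _ igg S12)// (RintegralD _ S1 S2)// E1 E2.
under eq_bigr => i _ do rewrite (RintegralZl _ measurableT (ige i)).
under [X in _ <= _ + (_ + X) -> _]eq_bigr => i _.
  rewrite (integrable_Rintegral_sum (index_enum 'I_n) (i2 i)).2.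
  under eq_bigr => j _ do rewrite (RintegralZl _ measurableT (iee i j)) ort.
  rewrite (bigD1 i)//= eqxx big1 ?addr0; last first.
    by move=> j ji; rewrite eq_sym (negbTE ji) mulr0.
  over.
move=> H; rewrite -subr_ge0; apply: le_trans H _.
rewrite lerD2l -big_split -sumrN/= ler_sum// => i _.
rewrite -/(c i).
have := v1 i; have := sqr_ge0 (c i); rewrite expr2; nra.
Qed.

End bessel.

(** * Covariances of indicators *)

Section indicator_covariance.
Context d (T : measurableType d) (R : realType) (P : probability T R).
Implicit Types A B : set T.

Definition set_covariance A B : R :=
  fine (P (A `&` B)) - fine (P A) * fine (P B).

Lemma integrable_EFin_indic A : measurable A ->
  P.-integrable setT (EFin \o (\1_A : T -> R)).
Proof. exact: integrable_indic. Qed.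

Lemma Rintegral_indic A : measurable A -> \int[P]_x \1_A x = fine (P A).
Proof. by move=> mA; rewrite /Rintegral integral_indic// setIT. Qed.

Lemma covariance_indic A B : measurable A -> measurable B ->
  covariance P \1_A \1_B = (set_covariance A B)%:E.
Proof.
move=> mA mB.
have iL C : measurable C -> (\1_C : T -> R) \in Lfun P 1%:E.
  by move=> mC; apply/Lfun1_integrable; exact: integrable_EFin_indic.
have ABE : (\1_A * \1_B : T -> R)%R = \1_(A `&` B) by rewrite indicI.
have mAB := measurableI _ _ mA mB.
rewrite covarianceE; [|exact: iL|exact: iL|by rewrite ABE; exact: iL].
rewrite ABE !expectation_indic// /set_covariance EFinB EFinM.
by rewrite !fineK// fin_num_measure.
Qed.

(** Centering one of the two factors is enough to turn an inner product into a
    covariance. *)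
Lemma Rintegral_indic_centered A B : measurable A -> measurable B ->
  P.-integrable setT (EFin \o (fun x => \1_A x * (\1_B x - fine (P B)))) /\
  \int[P]_x (\1_A x * (\1_B x - fine (P B))) = set_covariance A B.
Proof.
move=> mA mB; have mAB := measurableI _ _ mA mB.
have -> : (fun x => \1_A x * (\1_B x - fine (P B))) =
    (fun x => \1_(A `&` B) x - fine (P B) * \1_A x) :> (T -> R).
  by apply/funext => x; rewrite indicI mulrBr (mulrC (fine _)).
have iA := integrable_EFin_indic mA; have iAB := integrable_EFin_indic mAB.
have iBA : P.-integrable setT (EFin \o (fun x => fine (P B) * \1_A x)).
  exact: (integrableZl _ _ iA).
split; first exact: (integrableB _ iAB iBA).
rewrite (RintegralB _ iAB iBA)// (RintegralZl _ _ iA)//.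
by rewrite !Rintegral_indic// mulrC.
Qed.

(** Bessel's inequality for the centered indicators of the events E i, which
    are orthogonal since the events are pairwise uncorrelated. *)
Lemma sum_sqr_set_covariance_le1 n (A : set T) (E : 'I_n -> set T) :
  measurable A -> (forall i, measurable (E i)) ->
  (forall i j, i != j -> set_covariance (E i) (E j) = 0) ->
  \sum_(i < n) (set_covariance A (E i)) ^+ 2 <= 1.
Proof.
move=> mA mE indE.
pose e i x : R := \1_(E i) x - fine (P (E i)).
have iAe i := Rintegral_indic_centered mA (mE i).
have iEe i j := Rintegral_indic_centered (mE i) (mE j).
have iTe i := Rintegral_indic_centered measurableT (mE i).
have i0 i : set_covariance setT (E i) = 0.
  by rewrite /set_covariance setTI probability_setT mul1r subrr.
have AA : (fun x => \1_A x * \1_A x) = \1_A :> (T -> R).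
  by apply/funext => x; rewrite indicE; case: (_ \in _); rewrite ?mulr1 ?mulr0.
have iee i j : P.-integrable setT (EFin \o (fun x => e i x * e j x)) /\
    \int[P]_x (e i x * e j x) = set_covariance (E i) (E j).
  have -> : (fun x => e i x * e j x) = (fun x => \1_(E i) x * e j x -
      fine (P (E i)) * (\1_setT x * e j x)).
    by apply/funext => x; rewrite /e indicT mul1r mulrBl.
  have i2 : P.-integrable setT
      (EFin \o (fun x => fine (P (E i)) * (\1_setT x * e j x))).
    exact: (integrableZl _ _ (iTe j).1).
  split; first exact: (integrableB _ (iEe i j).1 i2).
  rewrite (RintegralB _ (iEe i j).1 i2)// (RintegralZl _ _ (iTe j).1)//.
  by rewrite (iEe i j).2 (iTe j).2 i0 mulr0 subr0.
have -> : \sum_(i < n) (set_covariance A (E i)) ^+ 2 =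
    \sum_(i < n) (\int[P]_x (\1_A x * e i x)) ^+ 2.
  by apply: eq_bigr => i _; rewrite (iAe i).2.
apply: le_trans (Bessel_inequality (v := fun i => set_covariance (E i) (E i))
  _ _ _ _ _) _.
- by rewrite AA; exact: integrable_EFin_indic.
- by move=> i; exact: (iAe i).1.
- by move=> i j; exact: (iee i j).1.
- move=> i j; rewrite (iee i j).2.
  by have [->//|ij] := eqVneq i j; exact: indE.
- move=> i; rewrite /set_covariance setIid.
  (* p - p ^+ 2 <= 1 for every real p; the square of p - 1 shows it *)
  have := sqr_ge0 (fine (P (E i)) - 1); rewrite sqrrB; nra.
- rewrite AA Rintegral_indic// -lee_fin fineK ?fin_num_measure//.
  exact: probability_le1.
Qed.

End indicator_covariance.

(** * Covariances of the shifted ball with half-spaces *)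

Section gaussian_facts.
Context {R : realType} {n : nat}.
Local Notation RR := (measurableTypeR R).
Implicit Types (x y a : n.-tuple R) (T : n.-tuple R -> n.-tuple R).

Lemma measurable_dotp d (X : measurableType d) (f g : X -> n.-tuple R) :
  measurable_fun setT f -> measurable_fun setT g ->
  measurable_fun setT (fun w => dotp (f w) (g w)).
Proof.
move=> /measurable_fun_tnthP mf /measurable_fun_tnthP mg.
apply: measurable_sum => i; apply: measurable_funM; [exact: mf|exact: mg].
Qed.

Lemma measurable_lin_comb (c d : R) : measurable_fun setT
  (fun z : n.-tuple R * n.-tuple R => lin_comb c z.1 d z.2).
Proof.
apply/measurable_fun_tnthP => i.
rewrite (_ : _ \o _ = fun z : n.-tuple R * n.-tuple R =>
  c * tnth z.1 i + d * tnth z.2 i); last first.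
  by apply/funext => z /=; rewrite tnth_mktuple.
have mi := @measurable_tnth _ R n i.
apply: measurable_funD; apply: measurable_funM => //.
  exact: (measurableT_comp mi measurable_fst).
exact: (measurableT_comp mi measurable_snd).
Qed.

Definition halfspace a (b : R) : set (n.-tuple R) := [set x | dotp x a <= b].

Definition noisy_ball (t : R) y : set (n.-tuple R) :=
  [set x | sqrt_ball (lin_comb (Num.sqrt (1 - expR (- (2 * t)))) x
                               (expR (- t)) y)].

Lemma g_indic t y : g_ t y = \1_(noisy_ball t y).
Proof. by apply/funext => x; rewrite /g_ !indicE. Qed.

Lemma sqrt_ballE x : sqrt_ball x <-> dotp x x <= n%:R.
Proof. by rewrite /sqrt_ball/= /enorm ler_sqrt// ler0n. Qed.

Lemma measurable_halfspace a b : measurable (halfspace a b).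
Proof.
rewrite -[halfspace a b]setTI; apply: measurable_fun_le => //.
exact: measurable_dotp.
Qed.

Lemma measurable_noisy_ball2 t : measurable
  [set z : n.-tuple R * n.-tuple R | noisy_ball t z.2 z.1].
Proof.
set l := fun z : n.-tuple R * n.-tuple R =>
  lin_comb (Num.sqrt (1 - expR (- (2 * t)))) z.1 (expR (- t)) z.2.
rewrite (_ : [set z | _] = setT `&` [set z | dotp (l z) (l z) <= n%:R]).
  apply: measurable_fun_le => //.
  by apply: measurable_dotp; exact: measurable_lin_comb.
by rewrite setTI; apply/seteqP; split=> z /sqrt_ballE.
Qed.

Lemma measurable_noisy_ball t y : measurable (noisy_ball t y).
Proof.
rewrite (_ : noisy_ball t y =
  ysection [set z : n.-tuple R * n.-tuple R | noisy_ball t z.2 z.1] y).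
  by apply: measurable_ysection; exact: measurable_noisy_ball2.
by apply/seteqP; split=> x; rewrite /ysection/= in_setE.
Qed.

Definition halfspace_cov (t b : R) a y : R :=
  set_covariance (gaussian R n) (noisy_ball t y) (halfspace a b).

(** The set is the section at y of a measurable subset of the product space, so
    that its measure depends measurably on y. *)
Lemma measurable_gaussian_noisy_ball t (A : set (n.-tuple R)) : measurable A ->
  measurable_fun setT (fun y => fine (gaussian R n (noisy_ball t y `&` A))).
Proof.
move=> mA; apply: (measurableT_comp (fine_measurable measurableT)).
pose W := [set z : n.-tuple R * n.-tuple R | noisy_ball t z.2 z.1] `&`
  (A `*` setT).
rewrite (_ : (fun y => _) = gaussian R n \o ysection W).
  apply: measurable_fun_ysection; apply: measurableI.
    exact: measurable_noisy_ball2.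
  exact: measurableX.
apply/funext => y /=; congr (gaussian R n _).
apply/seteqP; split=> x; rewrite /ysection/= in_setE /W/=.
  by move=> [].
by move=> [? []].
Qed.

Lemma measurable_halfspace_cov t b a :
  measurable_fun setT (halfspace_cov t b a).
Proof.
apply: measurable_funB.
  exact: (measurable_gaussian_noisy_ball t (measurable_halfspace a b)).
apply: measurable_funM => //.
have := measurable_gaussian_noisy_ball t (@measurableT _ (n.-tuple R)).
by under eq_fun do rewrite setIT.
Qed.

Lemma gaussian_isometry_preimage T (B : set (n.-tuple R)) :
  gaussian_isometry T -> measurable B ->
  gaussian R n (T @^-1` B) = gaussian R n B.
Proof.
move=> [mT iT _ _] mB.
have mTB : measurable (T @^-1` B).
  by rewrite -[X in measurable X]setTI; exact: mT.
rewrite -(setIT (T @^-1` B)) -[in RHS](setIT B) -!integral_indic//.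
rewrite -(iT (fun x => (\1_B x)%:E)) => [| |x]; last 2 first.
- exact/measurable_EFinP.
- by rewrite lee_fin.
by apply: eq_integral => x _; rewrite !indicE.
Qed.

(** Linearity of T moves it out of the combination of x and y, and the ball
    only sees norms. *)
Lemma noisy_ball_isometry T t y : gaussian_isometry T ->
  T @^-1` (noisy_ball t (T y)) = noisy_ball t y.
Proof.
move=> [_ _ lT dT]; apply/seteqP; split=> x.
  by move=> /sqrt_ballE H; apply/sqrt_ballE; rewrite -dT lT.
by move=> /sqrt_ballE H; apply/sqrt_ballE; rewrite -lT dT.
Qed.

Lemma halfspace_cov_isometry T t b a a' y : gaussian_isometry T ->
  (forall x, dotp (T x) a = dotp x a') ->
  halfspace_cov t b a (T y) = halfspace_cov t b a' y.
Proof.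
move=> iT Ta; rewrite /halfspace_cov /set_covariance.
have hE : T @^-1` (halfspace a b) = halfspace a' b.
  by apply/seteqP; split=> x; rewrite /halfspace/= Ta.
have mS := measurable_noisy_ball t (T y); have mH := measurable_halfspace a b.
rewrite -(gaussian_isometry_preimage iT (measurableI _ _ mS mH)).
rewrite -(gaussian_isometry_preimage iT mS) -(gaussian_isometry_preimage iT mH).
by rewrite preimage_setI noisy_ball_isometry// hE.
Qed.

Definition mean_sqr_halfspace_cov t b a : \bar R :=
  (\int[gaussian R n]_y (halfspace_cov t b a y ^+ 2)%:E)%E.

Lemma measurable_halfspace_cov_sqr t b a :
  measurable_fun setT (fun y => (halfspace_cov t b a y ^+ 2)%:E).
Proof.
apply/measurable_EFinP; apply: measurable_funX.
exact: measurable_halfspace_cov.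
Qed.

Lemma mean_sqr_halfspace_cov_isometry T t b a a' : gaussian_isometry T ->
  (forall x, dotp (T x) a = dotp x a') ->
  mean_sqr_halfspace_cov t b a = mean_sqr_halfspace_cov t b a'.
Proof.
move=> iT Ta; rewrite /mean_sqr_halfspace_cov.
have ge0 x : (0 <= (halfspace_cov t b a x ^+ 2)%:E)%E.
  by rewrite lee_fin sqr_ge0.
rewrite -(isom_integral iT (measurable_halfspace_cov_sqr t b a) ge0).
by apply: eq_integral => y _; rewrite (halfspace_cov_isometry _ _ _ iT Ta).
Qed.

Definition axis (r : R) (i : 'I_n) : n.-tuple R :=
  [tuple if j == i then r else 0 | j < n].

Lemma dotp_axis x r i : dotp x (axis r i) = r * tnth x i.
Proof.
rewrite /dotp (bigD1 i)//= big1 ?addr0 => [|j ji].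
  by rewrite tnth_mktuple eqxx mulrC.
by rewrite tnth_mktuple (negbTE ji) mulr0.
Qed.

Lemma gaussian_coordinate (B : set RR) i : measurable B ->
  gaussian R n [set x | B (tnth x i)] = normal_prob 0 1 B.
Proof.
move=> mB; pose C k : set RR := if k == i then B else setT.
have mC k : measurable (C k) by rewrite /C; case: ifP.
rewrite (_ : [set x | _] = [set x | forall k, C k (tnth x k)]).
  rewrite gaussian_box// (bigD1 i)//= big1 => [|k ki].
    by rewrite mule1 /C eqxx.
  by rewrite /C (negbTE ki) probability_setT.
apply/seteqP; split=> x /=; rewrite /C.
  by move=> Bx k; case: eqP => // ->.
by move=> /(_ i); rewrite eqxx.
Qed.

Lemma gaussian_coordinate2 (B B' : set RR) i j : i != j ->
  measurable B -> measurable B' ->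
  gaussian R n ([set x | B (tnth x i)] `&` [set x | B' (tnth x j)]) =
  (normal_prob 0 1 B * normal_prob 0 1 B')%E.
Proof.
move=> ij mB mB'.
pose C k : set RR := if k == i then B else if k == j then B' else setT.
have mC k : measurable (C k) by rewrite /C; do 2 case: ifP => //.
rewrite (_ : _ `&` _ = [set x | forall k, C k (tnth x k)]).
  rewrite gaussian_box// (bigD1 i)//= (bigD1 j) ?(eq_sym j)//= big1 => [|k].
    by rewrite mule1 /C eqxx eq_sym (negbTE ij) eqxx.
  by move=> /andP[ki kj]; rewrite /C (negbTE ki) (negbTE kj) probability_setT.
apply/seteqP; split=> x /=; rewrite /C.
  by move=> [Bx B'x] k; case: eqP => [->//|_]; case: eqP => // ->.
move=> H; split; first by have := H i; rewrite eqxx.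
by have := H j; rewrite eq_sym (negbTE ij) eqxx.
Qed.

(** These half-spaces constrain two different coordinates, which are
    independent under a product measure. *)
Lemma set_covariance_halfspace_axis r b i j : i != j ->
  set_covariance (gaussian R n)
    (halfspace (axis r i) b) (halfspace (axis r j) b) = 0.
Proof.
move=> ij; pose B : set RR := [set z | r * z <= b].
have mB : measurable B.
  by rewrite -[B]setTI; apply: measurable_fun_le => //; exact: measurable_funM.
have hE k : halfspace (axis r k) b = [set x | B (tnth x k)].
  by apply/seteqP; split=> x; rewrite /halfspace/= dotp_axis.
rewrite /set_covariance !hE gaussian_coordinate2// !gaussian_coordinate//.
by rewrite fineM ?fin_num_measure// subrr.
Qed.

Lemma sum_mean_sqr_halfspace_cov_axis t b r :
  (\sum_(i < n) mean_sqr_halfspace_cov t b (axis r i) <= 1)%E.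
Proof.
rewrite -ge0_integral_sum//=; last 2 first.
- by move=> i; exact: measurable_halfspace_cov_sqr.
- by move=> i y _; rewrite lee_fin sqr_ge0.
rewrite -(@probability_setT _ _ _ (gaussian R n)) -[leRHS]mul1e.
rewrite -integral_cst//; apply: ge0_le_integral => //.
- by move=> y _; apply: sume_ge0 => i _; rewrite lee_fin sqr_ge0.
- by apply: emeasurable_sum => i; exact: measurable_halfspace_cov_sqr.
- move=> y _; rewrite sumEFin lee_fin.
  apply: sum_sqr_set_covariance_le1.
  + exact: measurable_noisy_ball.
  + by move=> i; exact: measurable_halfspace.
  + by move=> i j; exact: set_covariance_halfspace_axis.
Qed.

End gaussian_facts.

(** * The second moment and the deviation bound *)

(** By isometry invariance all n + 1 axes give the same mean square as a, and
    these equal numbers add up to at most 1. *)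
Lemma mean_sqr_halfspace_cov_le (R : realType) n (t b : R) (a : n.+1.-tuple R) :
  (mean_sqr_halfspace_cov t b a <= (n.+1%:R^-1)%:E)%E.
Proof.
have [T [r [iT Ta _ _]]] := exists_gaussian_isometry a.
have aE (i : 'I_n.+1) :
    mean_sqr_halfspace_cov t b a = mean_sqr_halfspace_cov t b (axis r i).
  rewrite (mean_sqr_halfspace_cov_isometry t b iT (a' := axis r ord0));
    last by move=> x; rewrite Ta dotp_axis.
  (* the i-th axis has unit length and nonnegative entries, so it is aligned
     with the first axis with factor exactly 1 *)
  have [T' [r' [iT' Ta' r'2 r'0]]] :=
    exists_gaussian_isometry (axis (1 : R) i).
  have r'1 : r' = 1.
    apply/eqP; rewrite -sqrp_eq1; last first.
      by apply: r'0 => j; rewrite tnth_mktuple; case: ifP.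
    by rewrite r'2 dotp_axis mul1r tnth_mktuple eqxx.
  symmetry; apply: (mean_sqr_halfspace_cov_isometry t b iT') => x.
  rewrite !dotp_axis; have := Ta' x; rewrite dotp_axis mul1r => ->.
  by rewrite r'1 mul1r.
have := @sum_mean_sqr_halfspace_cov_axis R n.+1 t b r.
under eq_bigr do rewrite -aE.
have M0 : (0 <= mean_sqr_halfspace_cov t b a)%E.
  by apply: integral_ge0 => y _; rewrite lee_fin sqr_ge0.
case: (mean_sqr_halfspace_cov t b a) M0 => [m|_|//].
  rewrite sumEFin sumr_const card_ord !lee_fin => _ m1.
  by rewrite -[leRHS]mul1r ler_pdivlMr ?ltr0n// mulr_natr.
have S0 : (0 <= \sum_(i < n) (+oo : \bar R))%E by apply: sume_ge0.
rewrite big_ord_recl addye; first by rewrite leye_eq.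
by rewrite gt_eqF// (lt_le_trans _ S0).
Qed.

Lemma second_moment_deviation d (T : measurableType d) (R : realType)
    (P : probability T R) (X : {RV P >-> R}) (m v : R) : 0 < v ->
  (\int[P]_w (X w ^+ 2)%:E <= m%:E)%E ->
  ((1 - m / v ^+ 2)%:E <= P [set w | (`|X w| <= v)%R])%E.
Proof.
move=> v0 Xm; pose B := [set w | `|X w| <= v].
pose C := [set w | (v%:E <= `|(X w)%:E|)%E].
have mnX : measurable_fun setT (fun w => `|X w|) by exact: measurableT_comp.
have mB : measurable B.
  by rewrite -[B]setTI; exact: measurable_fun_le.
have mC : measurable C.
  rewrite (_ : C = setT `&` [set w | v <= `|X w|]).
    exact: measurable_fun_le.
  by rewrite setTI; apply/seteqP; split=> w; rewrite /C/= lee_fin.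
have PB : P B \is a fin_num by exact: fin_num_measure.
have PC : P C \is a fin_num by exact: fin_num_measure.
have markovE : ((v ^+ 2)%:E * P C <= m%:E)%E.
  apply: le_trans Xm.
  apply: le_trans (@markov _ _ _ P X (fun x => x ^+ 2) v v0 _ _ _) _.
  - exact: measurable_funX.
  - by move=> r _; exact: sqr_ge0.
  - by move=> x y; rewrite !nnegrE => x0 y0 xy; rewrite ler_pXn2r.
  - rewrite unlock le_eqVlt; apply/orP; left; apply/eqP.
    by apply: eq_integral => w _; rewrite /= real_normK// num_real.
have PCle : (P C <= (m / v ^+ 2)%:E)%E.
  move: markovE; rewrite -(fineK PC) -EFinM !lee_fin => h.
  by rewrite ler_pdivlMr ?exprn_gt0// mulrC.
have PBC : (P (~` B) <= (m / v ^+ 2)%:E)%E.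
  apply: le_trans (le_measure _ _ _ _) PCle; rewrite ?inE//.
    exact: measurableC.
  by move=> w; rewrite /B/C/= lee_fin => /negP; rewrite -ltNge => /ltW.
rewrite probability_setC// -(fineK PB) -EFinB lee_fin in PBC.
by rewrite -(fineK PB) lee_fin; lra.
Qed.

Theorem proposition2p4 (R : realType) (n : nat) (hn : (1 <= n)%N)
  (t : R) (ht : 0 <= t) (A : set (n.-tuple R)) (hA : half_space A)
  (d : measure_display) (Omega : measurableType d) (P : probability Omega R)
  (Y : {RV P >-> n.-tuple R}) (hY : standard_gaussian_vector P Y) :
  (\int[P]_w (covariance (gaussian R n) (g_ t (Y w)) \1_A ^+ 2)
     <= (n%:R^-1)%:E)%E
  /\
  forall u : R, 0 < u ->
    ((1 - u ^- 2)%:E <=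
      P [set w | `|covariance (gaussian R n) (g_ t (Y w)) \1_A|
                   <= (u / Num.sqrt n%:R)%:E])%E.
Proof.
case: n hn A hA Y hY => // n _ A [a [b AE]] Y hY.
pose K y := halfspace_cov t b a y.
have covE w : covariance (gaussian R n.+1) (g_ t (Y w)) \1_A = (K (Y w))%:E.
  rewrite g_indic AE covariance_indic//; first exact: measurable_noisy_ball.
  exact: measurable_halfspace.
have mK : measurable_fun setT K by exact: measurable_halfspace_cov.
have mKY : measurable_fun setT (K \o Y).
  by apply: (measurableT_comp mK); exact: measurable_funP.
have le_mean : (\int[P]_w ((K (Y w)) ^+ 2)%:E <= (n.+1%:R^-1)%:E)%E.
  apply: le_trans (mean_sqr_halfspace_cov_le t b a).
  have mK2 := measurable_halfspace_cov_sqr t b a.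
  have K20 y : (0 <= (K y ^+ 2)%:E)%E by rewrite lee_fin sqr_ge0.
  rewrite -[leLHS](ge0_integral_distribution Y mK2 K20).
  by rewrite le_eqVlt; apply/orP; left; apply/eqP;
    apply: eq_measure_integral => B mB _; exact: hY.
split.
  by under eq_integral do rewrite covE -EFin_expe.
move=> u u0; pose v := u / Num.sqrt n.+1%:R.
have v0 : 0 < v by rewrite divr_gt0// sqrtr_gt0 ltr0n.
pose X : {RV P >-> R} := HB.pack (K \o Y : Omega -> R)
  (isMeasurableFun.Build _ _ _ _ (K \o Y : Omega -> R) mKY).
have -> : [set w | (`|covariance (gaussian R n.+1) (g_ t (Y w)) \1_A| <=
    v%:E)%E] = [set w | `|X w| <= v].
  by apply/seteqP; split=> w /=; rewrite covE lee_fin.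
have -> : u ^- 2 = n.+1%:R^-1 / v ^+ 2.
  by rewrite expr_div_n sqr_sqrtr// invf_div mulKf.
exact: (@second_moment_deviation _ _ _ P X _ v v0 le_mean).
Qed.
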